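(* Let $\sigma$ be a smooth differential form of degree $q$ ($\le m-1$) on $\mathbb R^m$ (with $|d\sigma|<1$) satisfying $$d*\left(\frac{d\sigma}{\sqrt{1-|d\sigma|^2}}\right)=\tau_0,$$ where $\tau_0$ is a constant $(m-q)$-form. If $$\frac1{\sqrt{1-|d\sigma|^2}}=o(r)\quad\text{as } r\to\infty,$$ where $r$ is the distance from the origin, then $\tau_0=0$.
   Context: $*$ is the Hodge star operator of the Euclidean metric on $\mathbb R^m$, and $|\cdot|$ is the pointwise Euclidean norm of differential forms, for which the forms $dx_{j_1}\wedge\cdots\wedge dx_{j_k}$, $j_1<\cdots<j_k$, are orthonormal. A constant form is one with constant coefficients in the standard coordinates. The condition $|d\sigma|<1$ is what makes the equation meaningful. *)

(* Defs.v *)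
From HB Require Import structures.
From mathcomp Require Import all_boot all_order all_algebra.
From mathcomp Require Import all_classical all_reals all_analysis.

Set Implicit Arguments.
Unset Strict Implicit.
Unset Printing Implicit Defensive.

Import Order.TTheory GRing.Theory Num.Theory.
Import numFieldNormedType.Exports.

Local Open Scope ring_scope.

(* Exterior algebra of (R^m)^*: [w I] is the coefficient of
   dx_I = dx_{j1} /\ ... /\ dx_{jk}, where j1 < ... < jk enumerate I. *)
Notation ext R m := {ffun {set 'I_m} -> (R : realType)^o}.

(* A differential form on R^m.  The library norm on 'rV[R]_m is the sup norm;
   it is used here only through the topology it induces. *)
Notation dform R m := ('rV[R : realType]_m -> ext R m).

Definition homogeneous {R : realType} {m : nat} (k : nat) (w : ext R m) :=
  forall I : {set 'I_m}, #|I| != k -> w I = 0.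

Definition dxs {R : realType} {m : nat} (I : {set 'I_m}) : ext R m :=
  [ffun J : {set 'I_m} => (J == I)%:R].

Definition dx {R : realType} {m : nat} (j : 'I_m) : ext R m := dxs [set j]%SET.

(* For disjoint I and J, dx_I /\ dx_J = shuffle_sign I J * dx_{I :|: J}: the
   exponent counts the inversions of the juxtaposition of I and J. *)
Definition shuffle_sign {R : realType} {m : nat} (I J : {set 'I_m}) : R :=
  (-1) ^+ #|[set p in finset.setX I J | (p.2 < p.1)%N]%SET|.

Definition wedge {R : realType} {m : nat} (a b : ext R m) : ext R m :=
  [ffun K : {set 'I_m} => \sum_(I : {set 'I_m} | I \subset K)
     shuffle_sign I (K :\: I) * (a I * b (K :\: I))].

Definition inner {R : realType} {m : nat} (a b : ext R m) : R :=
  \sum_(I : {set 'I_m}) a I * b I.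

Definition ext_norm {R : realType} {m : nat} (a : ext R m) : R :=
  Num.sqrt (inner a a).

(* * dx_I = shuffle_sign I (~: I) dx_{~: I}; see [wedge_hodge]. *)
Definition hodge {R : realType} {m : nat} (b : ext R m) : ext R m :=
  [ffun K : {set 'I_m} => shuffle_sign (~: K) K * b (~: K)].

Definition partial {R : realType} {m : nat} (j : 'I_m) (f : 'rV[R]_m -> R^o) :
    'rV[R]_m -> R^o :=
  fun x => 'D_(delta_mx 0 j) f x.

(* d w = \sum_j dx_j /\ (partial derivative of w along j) *)
Definition ext_d {R : realType} {m : nat} (w : dform R m) : dform R m :=
  fun x => \sum_(j < m)
    wedge (dx j) [ffun I : {set 'I_m} => partial j (fun y => w y I) x].

(* C^oo: partial derivatives of all orders exist and are continuous *)
Definition smooth {R : realType} {m : nat} (f : 'rV[R]_m -> R^o) :=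
  forall s : seq 'I_m, let g := foldr partial f s in
    continuous g /\ forall (j : 'I_m) x, derivable g x (delta_mx 0 j).

Definition smooth_form {R : realType} {m : nat} (w : dform R m) :=
  forall I : {set 'I_m}, smooth (fun x => w x I).

Definition dist0 {R : realType} {m : nat} (x : 'rV[R]_m) : R^o :=
  Num.sqrt (\sum_(j < m) x 0 j ^+ 2).

(* The filter "r --> +oo" on R^m, r being the distance from the origin. *)
Definition at_infinity {R : realType} {m : nat} : set_system 'rV[R]_m :=
  filter_from [set: R] (fun rho => [set x : 'rV[R]_m | rho < dist0 x])%classic.

Global Instance at_infinity_filter (R : realType) (m : nat) :
  Filter (@at_infinity R m).
Proof.
apply: filter_fromT_filter; first by exists 0.
move=> a b; exists (Num.max a b) => x /=.
by rewrite gt_max => /andP[].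
Qed.

Canonical at_infinity_filter_on (R : realType) (m : nat) :=
  FilterType (@at_infinity R m) (@at_infinity_filter R m).

Lemma littleo_at_infinityP (R : realType) (m : nat) (f g : 'rV[R]_m -> R^o) :
  f =o_at_infinity g <->
  forall e : R, 0 < e -> exists rho : R, forall x : 'rV[R]_m,
    rho < dist0 x -> `|f x| <= e * `|g x|.
Proof.
split.
- by move/eqoP => fg e /fg[rho _ H]; exists rho.
- by move=> H; apply/eqoP => e /H[rho K]; exists rho.
Qed.

Lemma wedge_dxs (R : realType) (m : nat) (I : {set 'I_m}) :
  foldr wedge (dxs (@finset.set0 _)) [seq dx j | j <- enum I] = dxs I :> ext R m.
Proof.
suff gen (s : seq 'I_m) : sorted ltn [seq val j | j <- s] ->
    foldr wedge (dxs (@finset.set0 _)) [seq dx j | j <- s] = dxs [set:: s]%SET :> ext R m.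
  rewrite gen; first by congr dxs; apply/finset.setP => i; rewrite !inE mem_enum.
  rewrite {1}/enum_mem -enumT.
  have -> : [seq x <- enum 'I_m | mem I x] = enum I by rewrite enumT.
  have su : subseq [seq val j | j <- enum I] [seq val j | j <- enum 'I_m].
    by apply: map_subseq; rewrite enumT; apply: filter_subseq.
  apply: (subseq_sorted ltn_trans su).
  by rewrite val_enum_ord; apply: iota_ltn_sorted.
elim: s => [_|j s IHs] /=.
  by congr dxs; apply/finset.setP => i; rewrite !inE.
move=> js; rewrite IHs; last exact: path_sorted js.
have lt_js i : i \in s -> (j < i)%N.
  move=> si; move: js; rewrite (path_sortedE ltn_trans) => /andP[/allP + _].
  by apply; apply: map_f.
have jNs : j \notin s by apply/negP => /lt_js; rewrite ltnn.
apply/ffunP => K; rewrite !ffunE.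
have [->|neK] := eqVneq K [set:: j :: s]%SET.
  rewrite (bigD1 [set j]%SET) /=; last by rewrite finset.sub1set !inE eqxx.
  rewrite big1 ?addr0 => [|J /andP[_ /negPf neJ]]; last first.
    by rewrite ffunE neJ mul0r mulr0.
  have -> : ([set:: j :: s] :\: [set j])%SET = [set:: s]%SET.
    apply/finset.setP => i; rewrite !inE; case: eqVneq => //= ->.
    by rewrite (negPf jNs).
  rewrite !ffunE !eqxx !mulr1 /shuffle_sign.
  rewrite (_ : [set p in _ | _]%SET = finset.set0) ?cards0 ?expr0//.
  apply/finset.setP => -[a b]; rewrite !inE /=; apply/negP => /andP[/andP[/eqP-> sb]].
  by rewrite ltnNge (ltnW (lt_js _ sb)).
rewrite big1// => J JK; rewrite !ffunE.
case: eqVneq => [eJ|]; last by rewrite mul0r mulr0.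
case: eqVneq => [eK|]; last by rewrite mulr0 mulr0.
case/eqP: neK; apply/finset.setP => i; rewrite !inE.
move/finset.setP: eK => /(_ i); rewrite eJ !inE => <-.
case: eqVneq => //= ->; move: JK; rewrite eJ finset.sub1set => ->//.
Qed.

Lemma wedge_hodge (R : realType) (m q : nat) (a b : ext R m) :
  homogeneous q a -> homogeneous q b ->
  wedge a (hodge b) = inner a b *: dxs [set: 'I_m]%SET.
Proof.
move=> ha hb; apply/ffunP => K; rewrite !ffunE.
have [->|neK] := eqVneq K [set: 'I_m]%SET.
  rewrite /GRing.scale /= mulr1 /inner; apply: eq_big => [I|I _].
    by rewrite finset.subsetT.
  rewrite ffunE finset.setTD finset.setCK mulrCA [X in _ * X]mulrA /shuffle_sign.
  by rewrite -expr2 sqrr_sign mul1r.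
rewrite scaler0 big1// => I IK; rewrite ffunE.
have [eI|/ha->] := eqVneq #|I| q; last by rewrite mul0r mulr0.
rewrite [b _]hb ?mulr0//; apply: contra_neq neK => eC.
have IC : I \subset (~: (K :\: I))%SET.
  by apply/fintype.subsetP => i iI; rewrite !inE iI.
have /eqP eIC : I == (~: (K :\: I))%SET by rewrite eqEcard IC eI eC leqnn.
apply/eqP; rewrite finset.eqEsubset finset.subsetT /=; apply/fintype.subsetP => i _.
apply: contraT => iK; move/finset.setP: eIC => /(_ i); rewrite !inE (negPf iK) andbF.
by move/(fintype.subsetP IK); rewrite (negPf iK).
Qed.

(* Main.v *)
Require Import Defs.
From HB Require Import structures.
From mathcomp Require Import all_boot all_order all_algebra.
From mathcomp Require Import all_classical all_reals all_analysis.
From mathcomp Require Import ring.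

Import Order.TTheory GRing.Theory Num.Theory.
Import numFieldNormedType.Exports.

Local Open Scope ring_scope.

Set Implicit Arguments.
Unset Strict Implicit.
Unset Printing Implicit Defensive.

(** Write [gam] for 1 / sqrt (1 - |d sigma|^2) and [eta] for the form
    * (gam d sigma).  Fix a multi-index K.  The dx_K coefficient of d eta is

      sum over j in K of +- d_j eta_(K minus j),

    the divergence of the vector field F whose j-th component is
    +- eta_(K minus j) for j in K and 0 otherwise ([ext_dE]).  By hypothesis this
    divergence is the constant c = tau0_K.  Since the Hodge star permutes
    coefficients up to sign and |d sigma| < 1, we have |F_j| <= gam = o(r).

    A field with constant divergence c and growth o(r) has c = 0
    ([constant_div_eq0]): the divergence theorem on the cube [-r, r]^m equates
    c (2r)^m with a flux through 2m faces of area (2r)^(m-1) on which the field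
    is o(r), so c = o(1).

    The divergence theorem enters in a discrete form, which replaces integrals
    by finite sums.  On a grid of mesh h in the cube, the increments
    F_j (x + h e_j) - F_j x, summed over the grid, telescope to a difference of
    two opposite faces ([sum_increments_le]); on the other hand they are
    h d_j F_j (x) up to an error at most h eps, uniformly on the cube once h is
    small, because d_j F_j is uniformly continuous there
    ([unif_diff_quotient]).  Letting h and then eps shrink gives the bound.

    What this asks of F is to be of class C^1, and [eta] is, being built from
    first derivatives of the smooth form sigma by sums, products, and the
    inverse square root of a positive function. *)

(** * Functions of class C^1 *)

Definition C1 {R : realType} {m : nat} (f : 'rV[R]_m -> R^o) :=
  continuous f /\ forall j : 'I_m,
    (forall x, derivable f x (delta_mx 0 j)) /\ continuous (partial j f).

(** It is this loss of one derivative that makes d sigma, hence everything built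
    from it, of class C^1. *)
Lemma smooth_C1_partial (R : realType) (m : nat) (f : 'rV[R]_m -> R^o) j :
  smooth f -> C1 (partial j f).
Proof.
move=> sf; have [cf df] := sf [:: j]; split=> // i.
by split=> [x|]; [exact: df|exact: (sf [:: i; j]).1].
Qed.

Lemma C1_cst (R : realType) (m : nat) (a : R^o) : C1 (fun _ : 'rV[R]_m => a).
Proof.
split=> [x|j]; first exact: cst_continuous.
split=> [x|]; first exact: derivable_cst.
have -> : partial j (fun _ : 'rV[R]_m => a) = fun=> 0.
  by apply/funext => x; exact: derive_cst.
by move=> x; exact: cst_continuous.
Qed.

Lemma C1D (R : realType) (m : nat) (f g : 'rV[R]_m -> R^o) :
  C1 f -> C1 g -> C1 (fun x => f x + g x).
Proof.
move=> [cf df] [cg dg]; split=> [x|j]; first exact: cvgD (cf x) (cg x).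
have [dfj cdf] := df j; have [dgj cdg] := dg j.
split=> [x|]; first exact: derivableD.
have -> : partial j (fun x => f x + g x)
    = fun x => partial j f x + partial j g x.
  by apply/funext => x; exact: deriveD.
by move=> x; exact: cvgD (cdf x) (cdg x).
Qed.

Lemma C1M (R : realType) (m : nat) (f g : 'rV[R]_m -> R^o) :
  C1 f -> C1 g -> C1 (fun x => f x * g x : R).
Proof.
move=> [cf df] [cg dg]; split=> [x|j]; first exact: (@continuousM R _ f g x (cf x) (cg x)).
have [dfj cdf] := df j; have [dgj cdg] := dg j.
split=> [x|]; first exact: derivableM.
have -> : partial j (fun x => f x * g x : R)
    = fun x => f x * partial j g x + g x * partial j f x : R.
  by apply/funext => x; exact: deriveM.
move=> x; have cfg := @continuousM R _ f (partial j g) x (cf x) (cdg x).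
have cgf := @continuousM R _ g (partial j f) x (cg x) (cdf x).
exact: cvgD cfg cgf.
Qed.

Lemma C1_sum (R : realType) (m : nat) (I : Type) (s : seq I) (P : pred I)
    (F : I -> 'rV[R]_m -> R^o) :
  (forall i, P i -> C1 (F i)) -> C1 (fun x => \sum_(i <- s | P i) F i x).
Proof.
move=> C1F; elim: s => [|i s IHs].
  have -> : (fun x => \sum_(i <- [::] | P i) F i x) = fun=> 0.
    by apply/funext => x; rewrite big_nil.
  exact: C1_cst.
have -> : (fun x => \sum_(k <- i :: s | P k) F k x) = fun x =>
    (if P i then F i x else 0) + \sum_(k <- s | P k) F k x.
  by apply/funext => x; rewrite big_cons; case: ifP => // _; rewrite add0r.
apply: C1D IHs; case: (boolP (P i)) => [|_]; first exact: C1F.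
exact: (@C1_cst R m 0).
Qed.

Lemma C1V (R : realType) (m : nat) (f : 'rV[R]_m -> R^o) :
  (forall x, f x != 0) -> C1 f -> C1 (fun x => (f x : R)^-1).
Proof.
move=> f0 [cf df]; have cV : continuous (fun x => (f x : R)^-1 : R^o).
  by move=> x; exact: (@continuousV R _ f x (f0 x) (cf x)).
split=> // j; have [dfj cdf] := df j.
split=> [x|]; first exact: derivableV.
have -> : partial j (fun x => (f x : R)^-1)
    = fun x => - ((f x)^-1 * (f x)^-1) * partial j f x : R.
  by apply/funext => x; rewrite -invfM -expr2; exact: deriveV.
move=> x; have cVV := @continuousM R _ _ _ x (cV x) (cV x).
exact: (@continuousM R _ _ (partial j f) x (continuousN cVV) (cdf x)).
Qed.

(** Turns a directional derivative into an ordinary derivative, so that the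
    one-variable chain rule and mean value theorem apply to it. *)
Lemma is_derive_line (R : realType) (V W : normedModType R) (f : V -> W)
    (x v : V) (t : R) (df : W) :
  is_derive (t *: v + x) v f df -> is_derive t 1 (fun s => f (s *: v + x)) df.
Proof.
move=> [dv <-].
have quot : (fun h : R => h^-1 *: (f ((h *: 1 + t) *: v + x) - f (t *: v + x)))
    = (fun h => h^-1 *: (f (h *: v + (t *: v + x)) - f (t *: v + x))).
  by apply/funext => h; rewrite [h *: 1]mulr1 scalerDl addrA.
by split; rewrite /derivable /derive /= quot.
Qed.

(** Chain rule for a directional derivative, read off from the one-variable chain
    rule on the line t |-> x + t v. *)
Lemma is_derive_comp_line (R : realType) (V : normedModType R) (f : V -> R^o)
    (phi : R -> R) (x v : V) (df dphi : R) :
  is_derive x v f df -> is_derive (f x) 1 phi dphi ->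
  is_derive x v (fun y => phi (f y) : R^o) (dphi * df).
Proof.
move=> fd phid; pose g (h : R) : R := f (h *: v + x).
have g0 : g 0 = f x by rewrite /g scale0r add0r.
have dg : is_derive (0 : R) 1 g df.
  by apply: is_derive_line; rewrite scale0r add0r.
have dphig : derivable phi (g 0) 1 by rewrite g0; exact: ex_derive.
have dc : derivable (phi \o g) 0 1.
  by apply/derivable1_diffP; apply: differentiable_comp;
    apply/derivable1_diffP => //; exact: ex_derive.
have dfc : derivable (fun y => phi (f y) : R^o) x v.
  by apply/derivable1P; exact: dc.
split => //.
have /derivableP : derivable (fun y => phi (f y) : R^o) (0 *: v + x) v.
  by rewrite scale0r add0r.
case/is_derive_line => _; rewrite scale0r add0r => <-.
have := derive1_comp (@ex_derive _ _ _ _ _ _ _ dg) dphig.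
by rewrite !derive1E g0 [X in _ = X * _]derive_val [X in _ = _ * X]derive_val.
Qed.

Lemma C1_sqrt (R : realType) (m : nat) (f : 'rV[R]_m -> R^o) :
  (forall x, 0 < f x) -> C1 f -> C1 (fun x => Num.sqrt (f x) : R).
Proof.
move=> f0 [cf df].
have cS : continuous (fun x => Num.sqrt (f x) : R^o).
  move=> x; apply: continuous_comp; first exact: cf.
  exact: sqrt_continuous.
have dS j x : is_derive x (delta_mx 0 j) (fun x => Num.sqrt (f x) : R^o)
    ((2 * Num.sqrt (f x))^-1 * partial j f x).
  apply: is_derive_comp_line; last exact: is_derive1_sqrt.
  exact/derivableP/(df j).1.
split=> // j; split=> [x|]; first exact: ex_derive.
have -> : partial j (fun x => Num.sqrt (f x))
    = fun x => (2 * Num.sqrt (f x))^-1 * partial j f x.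
  by apply/funext => x; exact: derive_val.
move=> x; apply: (@continuousM R _ _ (partial j f) x _ ((df j).2 x)).
apply: (@continuousV R); first by rewrite mulf_neq0 // sqrtr_eq0 -ltNge.
by apply: (@continuousM R _ _ _ x _ (cS x)); exact: cst_continuous.
Qed.

(** * Uniform difference quotients on compact sets *)

(** Uniform continuity along the direction [v]: the increment is jointly
    continuous in the point and the step and vanishes at step 0, so compactness
    of [A] yields one step size valid for all points.  The points x + t v may
    leave [A]. *)
Lemma unif_increment (R : realType) (m : nat) (A : set 'rV[R]_m)
    (g : 'rV[R]_m -> R^o) (v : 'rV[R]_m) (eps : R) :
  compact A -> continuous g -> 0 < eps ->
  exists2 eta : R, 0 < eta & forall t x, `|t| < eta -> A x ->
    `|g (t *: v + x) - g x| <= eps.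
Proof.
move=> /compact_near_coveringP cA cg eps0.
have := cA R (nbhs (0 : R^o)) (fun t x => `|g (t *: v + x) - g x| <= eps) _.
case=> [x _|eta /= eta0 H].
  pose G (z : 'rV[R]_m * R^o) : R^o := g (z.2 *: v + z.1) - g z.1.
  have cG : {for (x, 0), continuous G}.
    have c1 : (z.1 @[z --> (x, 0 : R^o)] --> x)%classic by exact: cvg_fst.
    have c2 : (z.2 @[z --> (x, 0 : R^o)] --> (0 : R^o))%classic by exact: cvg_snd.
    apply: (@cvgB R R^o).
      apply: (@continuous_comp _ _ _ (fun z : 'rV[R]_m * R^o => z.2 *: v + z.1) g).
        apply: cvgD c1; exact: cvgZr_tmp c2.
      exact: cg.
    by apply: (@continuous_comp _ _ _ (fun z : 'rV[R]_m * R^o => z.1) g) => //; exact: cg.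
  have G0 : G (x, 0) = 0 by rewrite /G /= scale0r add0r subrr.
  have /cvgrPdist_le /(_ eps eps0) := cG.
  by rewrite G0; apply: filterS => -[y t] /=; rewrite sub0r normrN.
exists eta => // t x te Ax; apply: H => //.
by rewrite /ball /= sub0r normrN.
Qed.

(** By the mean value theorem the difference quotient is the partial derivative
    at an intermediate point, which [unif_increment] compares with its value at
    [x]. *)
Lemma unif_diff_quotient (R : realType) (m : nat) (A : set 'rV[R]_m)
    (f : 'rV[R]_m -> R^o) (j : 'I_m) (eps : R) :
  compact A -> C1 f -> 0 < eps ->
  exists2 eta : R, 0 < eta & forall h x, 0 < h < eta -> A x ->
    `|f (h *: delta_mx 0 j + x) - f x - h * partial j f x| <= h * eps.
Proof.
move=> cA [cf df] eps0; have [dfj cdf] := df j.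
have [eta eta0 Heta] := unif_increment (delta_mx 0 j) cA cdf eps0.
exists eta => // h x /andP[h0 he] Ax.
pose L (t : R) : R := f (t *: delta_mx 0 j + x).
have dL t : is_derive (t : R) 1 L (partial j f (t *: delta_mx 0 j + x)).
  exact/is_derive_line/derivableP.
have cL : {within `[0, h], continuous L}%classic.
  apply: derivable_within_continuous => t _; exact: ex_derive.
have [t] := MVT h0 (fun t _ => dL t) cL.
rewrite in_itv /= subr0 => /andP[t0 th].
rewrite /L scale0r add0r => ->.
rewrite [_ * h]mulrC -mulrBr normrM (gtr0_norm h0) ler_pM2l//.
by apply: Heta => //; rewrite gtr0_norm // (lt_trans th).
Qed.

(** * Telescoping sums over a grid in a cube *)

(** The shift is cyclic, which makes it a permutation of the grid: sums can be
    reindexed along it, and only the last layer moves other than by one mesh. *)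
Definition shift_coord (m N : nat) (j : 'I_m) (f : {ffun 'I_m -> 'I_N.+1}) :=
  [ffun i => if i == j then ordS (f i) else f i].

Lemma shift_coord_inj (m N : nat) (j : 'I_m) : injective (@shift_coord m N j).
Proof.
move=> f g /ffunP fg; apply/ffunP => i; move: (fg i); rewrite !ffunE.
by case: ifP => // _; apply: ordS_inj.
Qed.

(** The number of grid points in a face is N+1 to the power m-1; the product form
    avoids the truncated predecessor of [m]. *)
Lemma card_face (m N : nat) (j : 'I_m) (k : 'I_N.+1) :
  (#|[pred f : {ffun 'I_m -> 'I_N.+1} | f j == k]| * N.+1 = N.+1 ^ m)%N.
Proof.
pose F (i : 'I_m) (l : 'I_N.+1) : nat := (i == j) ==> (l == k).
have cardE : #|[pred f : {ffun 'I_m -> 'I_N.+1} | f j == k]|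
    = (\sum_(f : {ffun 'I_m -> 'I_N.+1}) \prod_i F i (f i))%N.
  rewrite -sum1_card big_mkcond; apply: eq_bigr => f _; rewrite inE.
  rewrite (bigD1 j) //= big1 ?muln1 /F ?eqxx => [|i /negPf-> //].
  by case: (f j == k).
rewrite cardE -bigA_distr_bigA (bigD1 j) //=.
have -> : (\sum_l F j l = 1)%N.
  by rewrite (bigD1 k) //= big1 /F eqxx ?eqxx // => l /negPf->.
rewrite mul1n -[in RHS](card_ord m) -prod_nat_const [RHS](bigD1 j) //= mulnC.
congr (_ * _)%N; apply: eq_bigr => i /negPf ij.
by rewrite /F ij sum1_card card_ord.
Qed.

(** The grid with N+1 points per side has mesh 2r/(N+1) and contains the faces
    x_j = -r but not the faces x_j = r, which are one step beyond it. *)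
Definition grid_point {R : realType} {m N : nat} (r : R)
    (f : {ffun 'I_m -> 'I_N.+1}) : 'rV[R]_m :=
  \row_i (2 * r / N.+1%:R * (f i)%:R - r).

Lemma grid_point_cube (R : realType) (m N : nat) (r : R)
    (f : {ffun 'I_m -> 'I_N.+1}) i :
  0 < r -> `|grid_point r f 0 i| <= r.
Proof.
move=> r0; rewrite mxE ler_norml lerBlDr lerDr (_ : r + r = 2 * r); last by rewrite mulr_natl mulr2n.
have h0 : 0 <= 2 * r / N.+1%:R :> R by rewrite divr_ge0 // mulr_ge0 // ltW.
rewrite mulr_ge0 //=; have fN : N.+1%:R^-1 * (f i)%:R <= 1 :> R.
  by rewrite mulrC ler_pdivrMr ?ltr0n // mul1r ler_nat ltnW.
by rewrite -[leLHS]mulrA ler_piMr // mulr_ge0 // ltW.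
Qed.

(** Discrete fundamental theorem of calculus in the direction [j]: after
    reindexing the subtracted sum by the cyclic shift, all terms cancel except
    those of the last layer, where the step leads to the face x_j = r and the
    shift wraps around to the face x_j = -r.  Hence only the values of [G] on these
    two faces matter. *)
Lemma sum_increments_le (R : realType) (m N : nat) (j : 'I_m) (r M h : R)
    (G : 'rV[R]_m -> R) :
  0 < r -> h = 2 * r / N.+1%:R ->
  (forall x : 'rV[R]_m, (forall i, `|x 0 i| <= r) -> `|x 0 j| = r -> `|G x| <= M) ->
  `|\sum_(f : {ffun 'I_m -> 'I_N.+1})
      (G (h *: delta_mx 0 j + grid_point r f) - G (grid_point r f))| * N.+1%:R
    <= 2 * M * (N.+1 ^ m)%:R.
Proof.
move=> r0 hE GM; pose P := @grid_point R m N r.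
have n0 : 0 < N.+1%:R :> R by rewrite ltr0n.
have step f i : (h *: delta_mx 0 j + P f) 0 i
    = if i == j then h * (f i).+1%:R - r else P f 0 i.
  rewrite !mxE eqxx /= -hE; case: eqVneq => [_|_]; last by rewrite mulr0 add0r.
  by rewrite -nat1r mulrDr addrA.
pose Q := [pred f : {ffun 'I_m -> 'I_N.+1} | f j == ord_max].
have inner_step f : ~~ Q f -> h *: delta_mx 0 j + P f = P (shift_coord j f).
  move=> fj; apply/rowP => i; rewrite step !mxE ffunE.
  case: eqVneq => [->|//]; rewrite -hE /= modn_small //.
  rewrite ltn_neqAle ltn_ord andbT; apply: contra fj => /eqP fN.
  by apply/eqP/val_inj => /=; case: fN.
have face_step f : Q f ->
    `|G (h *: delta_mx 0 j + P f) - G (P (shift_coord j f))| <= 2 * M.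
  move=> /eqP fj; rewrite mulr_natl mulr2n; apply: le_trans (ler_normB _ _) _.
  have rr : `|r| = r by exact: gtr0_norm.
  have hn : h * N.+1%:R = 2 * r by rewrite hE divfK // gt_eqF.
  apply: lerD; apply: GM => [i|].
  - rewrite step; case: eqVneq => [->|_]; last exact: grid_point_cube.
    by rewrite fj hn mulr_natl mulr2n addrK rr.
  - by rewrite step eqxx fj hn mulr_natl mulr2n addrK rr.
  - exact: grid_point_cube.
  - by rewrite mxE ffunE eqxx fj /= modnn mulr0 sub0r normrN rr.
rewrite sumrB [X in _ - X](reindex_inj (@shift_coord_inj m N j)) /= -sumrB.
rewrite (bigID Q) /= [X in _ + X]big1 ?addr0 => [|f fj]; last first.
  by rewrite inner_step // subrr.
rewrite -(card_face j ord_max) natrM mulrA ler_pM2r //.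
apply: le_trans (ler_norm_sum _ _ _) _.
apply: le_trans (ler_sum _ face_step) _.
by rewrite sumr_const mulr_natr.
Qed.

(** * Fields of constant divergence *)

Lemma dist0_cube (R : realType) (m : nat) (r : R) (x : 'rV[R]_m) :
  0 <= r -> (forall i, `|x 0 i| <= r) -> dist0 x <= m%:R * r.
Proof.
move=> r0 xr; rewrite -[leRHS]ger0_norm ?mulr_ge0 // -sqrtr_sqr.
apply: ler_wsqrtr; rewrite exprMn.
apply: (@le_trans _ _ (\sum_(i < m) r ^+ 2)).
  by apply: ler_sum => i _; rewrite -(real_normK (num_real _)) lerXn2r ?nnegrE.
rewrite sumr_const card_ord -[leLHS]mulr_natl ler_wpM2r ?exprn_ge0 //.
by rewrite -natrX ler_nat; case: (m) => // k; rewrite expnS leq_pmulr.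
Qed.

Lemma coord_le_dist0 (R : realType) (m : nat) (x : 'rV[R]_m) i :
  `|x 0 i| <= dist0 x.
Proof.
rewrite -sqrtr_sqr; apply: ler_wsqrtr; rewrite (bigD1 i) //= lerDl.
by apply: sumr_ge0 => k _; exact: sqr_ge0.
Qed.

(** On the boundary of the cube of half-side r > rho the distance to the origin
    lies between r and m r, so there |F_j| <= eps m r; the total flux is then at
    most m * 2 eps m r * (2r)^(m-1), that is m^2 eps times the volume.  Replacing
    derivatives by difference quotients costs a further m eps times the volume,
    whence |c| <= (m + m^2) eps. *)
Lemma constant_div_eq0 (R : realType) (m : nat) (F : 'I_m -> 'rV[R]_m -> R^o)
    (c : R) :
  (forall j, C1 (F j)) ->
  (forall x, \sum_j partial j (F j) x = c) ->
  (forall eps : R, 0 < eps -> exists rho : R, forall j x,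
     rho < dist0 x -> `|F j x| <= eps * dist0 x) ->
  c = 0.
Proof.
move=> C1F divF growth.
have key (eps : R) : 0 < eps -> `|c| <= (m%:R + m%:R ^+ 2) * eps.
  move=> eps0; have [rho Frho] := growth _ eps0.
  pose r := `|rho| + 1; have r0 : 0 < r by rewrite ltr_wpDl.
  have rho_r : rho < r by rewrite (le_lt_trans (ler_norm _)) // ltrDl.
  pose A := [set x : 'rV[R]_m | forall i, `[- r, r]%classic (x ord0 i)]%classic.
  have cA : compact A by apply: (@rV_compact _ _ (fun=> `[- r, r]%classic)) => _; exact: segment_compact.
  have /choice[eta etaP] j : exists eta : R, 0 < eta /\
      forall h x, 0 < h < eta -> A x ->
      `|F j (h *: delta_mx 0 j + x) - F j x - h * partial j (F j) x| <= h * eps.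
    by have [eta ? ?] := unif_diff_quotient j cA (C1F j) eps0; exists eta.
  (* N + 1 exceeds all the 2r / eta_j, so that the mesh is below every eta_j. *)
  pose N := \max_j Num.bound (2 * r / eta j).
  have n0 : 0 < N.+1%:R :> R by rewrite ltr0n.
  pose h := 2 * r / N.+1%:R; have h0 : 0 < h by rewrite divr_gt0 // mulr_gt0.
  have h_eta j : h < eta j.
    have [eta0 _] := etaP j.
    rewrite ltr_pdivrMr // -ltr_pdivrMl // [ltLHS]mulrC.
    have q0 : 0 <= 2 * r / eta j by rewrite divr_ge0 ?mulr_ge0 // ltW.
    apply: lt_le_trans (archi_boundP q0) _.
    by rewrite ler_nat ltnW // ltnS (leq_bigmax j).
  pose T := {ffun 'I_m -> 'I_N.+1}.
  pose D j (f : T) :=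
    F j (h *: delta_mx 0 j + grid_point r f) - F j (grid_point r f).
  have approx (f : T) : `|\sum_j D j f - h * c| <= m%:R * (h * eps).
    rewrite -(divF (grid_point r f)) mulr_sumr -sumrB.
    apply: le_trans (ler_norm_sum _ _ _) _.
    rewrite mulr_natl -[in leRHS](card_ord m) -sumr_const; apply: ler_sum => j _.
    apply: (etaP j).2; first by rewrite h0 h_eta.
    by move=> i /=; rewrite in_itv /= -ler_norml; exact: grid_point_cube.
  have flux j : `|\sum_f D j f| * N.+1%:R
      <= 2 * (eps * (m%:R * r)) * (N.+1 ^ m)%:R.
    apply: sum_increments_le => // x xr xj.
    apply: le_trans (Frho j x _) _.
      by rewrite (lt_le_trans rho_r) // -xj coord_le_dist0.
    by rewrite ler_pM2l // dist0_cube // ltW.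
  have cardT : #|T| = (N.+1 ^ m)%N by rewrite card_ffun !card_ord.
  have nm0 : 0 < (N.+1 ^ m)%:R :> R by rewrite ltr0n expn_gt0.
  have total : (N.+1 ^ m)%:R * (h * `|c|)
      <= (N.+1 ^ m)%:R * (m%:R * (h * eps)) + \sum_j `|\sum_f D j f|.
    have -> : (N.+1 ^ m)%:R * (h * `|c|) = `|\sum_(f : T) h * c|.
      by rewrite sumr_const cardT normrMn normrM (gtr0_norm h0) mulr_natl.
    have -> : \sum_(f : T) h * c
        = \sum_j \sum_f D j f - \sum_(f : T) (\sum_j D j f - h * c).
      by rewrite sumrB [X in X - _]exchange_big opprB addrC subrK.
    rewrite [leRHS]addrC; apply: le_trans (ler_normB _ _) _; apply: lerD.
      exact: ler_norm_sum.
    apply: le_trans (ler_norm_sum _ _ _) _.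
    by rewrite mulr_natl -cardT -sumr_const; apply: ler_sum => f _.
  have flux_sum : (\sum_j `|\sum_f D j f|) * N.+1%:R
      <= m%:R * (2 * (eps * (m%:R * r)) * (N.+1 ^ m)%:R).
    set B := (X in _ <= _ * X).
    have -> : m%:R * B = \sum_(j < m) B by rewrite sumr_const card_ord mulr_natl.
    rewrite mulr_suml.
    by apply: ler_sum => j _.
  have hn : h * N.+1%:R = 2 * r by rewrite divfK // gt_eqF.
  have W0 : 0 < (N.+1 ^ m)%:R * (2 * r) by rewrite !mulr_gt0.
  (* Multiplied by N + 1, both error terms become multiples of the
     volume-like quantity (N+1)^m * 2r, since h (N+1) = 2r. *)
  rewrite -(ler_pM2l W0).
  have := ler_wpM2r (ltW n0) total; rewrite mulrDl => {}total.
  have {total} := le_trans total (lerD (lexx _) flux_sum).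
  move: {flux_sum approx flux nm0 W0} ((N.+1 ^ m)%:R : R) => n_m.
  move: (N.+1%:R : R) hn => n hn.
  have -> : n_m * (h * `|c|) * n = n_m * (h * n) * `|c| by ring.
  have -> : n_m * (m%:R * (h * eps)) * n = n_m * (h * n) * (m%:R * eps) by ring.
  rewrite hn => /le_trans; apply; rewrite le_eqVlt; apply/orP; left.
  by apply/eqP; ring.
apply/eqP; rewrite -normr_le0; apply/ler_addgt0Pr => e e0; rewrite add0r.
have m1 : 0 < m%:R + m%:R ^+ 2 + 1 :> R by rewrite ltr_wpDl // addr_ge0.
apply: le_trans (key (e / (m%:R + m%:R ^+ 2 + 1)) _) _.
  by rewrite divr_gt0.
rewrite mulrA ler_pdivrMr // mulrC ler_pM2l // lerDl //.
Qed.

(** * Coefficients of the exterior derivative *)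

(** The sign in dx_j /\ dx_(K minus j) = +- dx_K, extended by 0 to j outside K so
    that d becomes a divergence over all coordinates. *)
Definition contract_sign {R : realType} {m : nat} (j : 'I_m) (K : {set 'I_m}) : R :=
  if j \in K then shuffle_sign [set j]%SET (K :\ j)%SET else 0.

Lemma ext_dE (R : realType) (m : nat) (w : dform R m) x (K : {set 'I_m}) :
  ext_d w x K
    = \sum_j contract_sign j K * partial j (fun y => w y (K :\ j)%SET) x.
Proof.
rewrite /ext_d sum_ffunE; apply: eq_bigr => j _; rewrite ffunE /contract_sign.
case: ifP => jK; last first.
  rewrite mul0r big1 // => I IK; rewrite !ffunE.
  case: eqVneq => [eI|]; last by rewrite mul0r mulr0.
  by move: IK; rewrite eI finset.sub1set jK.
rewrite (bigD1 [set j]%SET) ?finset.sub1set //= big1 ?addr0 => [|I /andP[_ Ij]].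
  by rewrite !ffunE eqxx mul1r.
by rewrite !ffunE (negPf Ij) mul0r mulr0.
Qed.

Lemma ext_norm_coord (R : realType) (m : nat) (w : ext R m) (I : {set 'I_m}) :
  `|w I| <= ext_norm w.
Proof.
rewrite -sqrtr_sqr /ext_norm; apply: ler_wsqrtr; rewrite /inner (bigD1 I) //=.
by rewrite expr2 lerDl; apply: sumr_ge0 => J _; rewrite -expr2 sqr_ge0.
Qed.

Lemma ext_norm_sqr (R : realType) (m : nat) (w : ext R m) :
  ext_norm w ^+ 2 = \sum_(I : {set 'I_m}) w I * w I.
Proof.
by rewrite sqr_sqrtr //; apply: sumr_ge0 => I _; rewrite -expr2 sqr_ge0.
Qed.

Lemma ext_d_C1 (R : realType) (m : nat) (w : dform R m) (K : {set 'I_m}) :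
  smooth_form w -> C1 (fun x => ext_d w x K).
Proof.
move=> sw; have -> : (fun x => ext_d w x K) = fun x =>
    \sum_j contract_sign j K * partial j (fun y => w y (K :\ j)%SET) x.
  by apply/funext => x; exact: ext_dE.
apply: C1_sum => j _; apply: C1M; first exact: C1_cst.
exact: smooth_C1_partial.
Qed.

Lemma partialZ (R : realType) (m : nat) (j : 'I_m) (a : R)
    (f : 'rV[R]_m -> R^o) :
  C1 f -> partial j (fun x => a * f x : R) = fun x => a * partial j f x : R.
Proof.
by move=> [_ /(_ j)[df _]]; apply/funext => x; exact: deriveZ.
Qed.

Lemma normr_contract_sign (R : realType) (m : nat) (j : 'I_m) (K : {set 'I_m}) :
  `|contract_sign j K : R| <= 1.
Proof.
by rewrite /contract_sign; case: ifP => _; rewrite ?normr0 ?normr_sign.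
Qed.

Theorem theorem9p3 (R : realType) (m q : nat) (sigma : dform R m)
    (tau0 : ext R m) :
  (q < m)%N ->
  smooth_form sigma ->
  (forall x, homogeneous q (sigma x)) ->
  homogeneous (m - q) tau0 ->
  (forall x, ext_norm (ext_d sigma x) < 1) ->
  (forall x,
     ext_d (fun y => hodge ((Num.sqrt (1 - ext_norm (ext_d sigma y) ^+ 2))^-1
                              *: ext_d sigma y)) x = tau0) ->
  (fun x => (Num.sqrt (1 - ext_norm (ext_d sigma x) ^+ 2))^-1 : R^o)%R
    =o_at_infinity dist0 ->
  tau0 = 0.
Proof.
move=> _ ssigma _ _ norm_lt1 deq growth.
set gam : 'rV[R]_m -> R^o :=
  fun x => (Num.sqrt (1 - ext_norm (ext_d sigma x) ^+ 2))^-1 in growth.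
have arg_gt0 x : 0 < 1 - ext_norm (ext_d sigma x) ^+ 2.
  by rewrite subr_gt0 expr_lt1 // sqrtr_ge0.
have C1gam : C1 gam.
  apply: C1V => [x|]; first by rewrite gt_eqF // sqrtr_gt0.
  apply: C1_sqrt => //.
  have -> : (fun x => 1 - ext_norm (ext_d sigma x) ^+ 2) = fun x =>
      1 + (-1) * \sum_(I : {set 'I_m}) ext_d sigma x I * ext_d sigma x I.
    by apply/funext => x; rewrite ext_norm_sqr mulN1r.
  apply: C1D; first exact: C1_cst.
  apply: C1M; first exact: C1_cst.
  by apply: C1_sum => I _; apply: C1M; exact: ext_d_C1.
pose eta : dform R m := fun y => hodge (gam y *: ext_d sigma y).
have etaE y I : eta y I
    = shuffle_sign (~: I)%SET I * (gam y * ext_d sigma y (~: I)%SET).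
  by rewrite /eta !ffunE.
have C1eta I : C1 (fun y => eta y I).
  have -> : (fun y => eta y I) = fun y =>
      shuffle_sign (~: I)%SET I * (gam y * ext_d sigma y (~: I)%SET).
    by apply/funext => y; exact: etaE.
  apply: C1M; first exact: C1_cst.
  by apply: C1M => //; exact: ext_d_C1.
have eta_le y I : `|eta y I| <= `|gam y|.
  rewrite etaE normrM normr_sign mul1r normrM ler_piMr //.
  exact: le_trans (ext_norm_coord _ _) (ltW (norm_lt1 y)).
apply/ffunP => K; rewrite [RHS]ffunE.
(* The vector field whose divergence is the dx_K coefficient of d eta. *)
apply: (@constant_div_eq0 R m
  (fun j y => contract_sign j K * eta y (K :\ j)%SET)).
- by move=> j; apply: C1M => //; exact: C1_cst.
- move=> x; rewrite -(deq x) ext_dE; apply: eq_bigr => j _.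
  by rewrite partialZ.
- move=> eps eps0; have /littleo_at_infinityP /(_ eps eps0)[rho Hrho] := growth.
  exists rho => j x /Hrho; rewrite [`|dist0 x|]ger0_norm ?sqrtr_ge0 //.
  apply: le_trans; rewrite normrM.
  apply: le_trans (ler_piMl _ (normr_contract_sign _ _ _)) (eta_le _ _).
  exact: normr_ge0.
Qed.
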